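(* Let $\mathcal X\subseteq\mathbb R^n$ and $\mathcal Y\subseteq\mathbb R^m$ be closed convex sets, $f:\mathcal X\to\mathbb R$ and $g:\mathcal Y\to\mathbb R$ convex functions, $A\in\mathbb R^{m\times n}$, $\alpha\in[0,1]$, and let $r,s>0$ satisfy $r\cdot s>(1-\alpha+\alpha^2)\rho(A^TA)$. Let $\{u^k\}$ be the sequence generated by the generalized CP-PPA with corresponding predictors $\tilde u^k$. Then there is a constant $c_0>0$, independent of $N$, such that for every positive integer $N$, $$\|M(u^N-\tilde u^N)\|_H^2\le\frac1{(N+1)c_0}\|u^0-u^*\|_H^2,\qquad\forall\,u^*\in\Omega^*.$$
   Context: $\rho(A^TA)$ is the largest eigenvalue of $A^TA$. Write $\mathcal L(x,y)=f(x)-y^TAx-g(y)$, $u=(x,y)\in\mathbb R^{n+m}$, $\Omega=\mathcal X\times\mathcal Y$, $\theta(u)=f(x)+g(y)$, and $F(u)=(-A^Ty,\;Ax)$. $\Omega^*$ is the set of all $u^*\in\Omega$ with $\theta(u)-\theta(u^* )+(u-u^* )^TF(u^* )\ge0$ for all $u\in\Omega$. Matrices: $Q=\begin{pmatrix} rI_n & A^T\\ \alpha A & sI_m\end{pmatrix}$, $M=\begin{pmatrix} I_n & 0\\ -(1-\alpha)\frac1sA & I_m\end{pmatrix}$, $H=QM^{-1}$. For a matrix $S$, $\|v\|_S^2:=v^TSv$. The generalized CP-PPA, started from some $u^0=(x^0,y^0)\in\mathbb R^n\times\mathbb R^m$, generates for $k=0,1,2,\dots$ $$x^{k+1}=\arg\min\{\mathcal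 L(x,y^k)+\tfrac r2\|x-x^k\|^2:x\in\mathcal X\},\quad \bar x^{k+1}=x^{k+1}+\alpha(x^{k+1}-x^k),$$ $$\bar y^{k+1}=\arg\max\{\mathcal L(\bar x^{k+1},y)-\tfrac s2\|y-y^k\|^2:y\in\mathcal Y\},\quad y^{k+1}=\bar y^{k+1}-(1-\alpha)\tfrac1sA(x^{k+1}-x^k),$$ where the term $f(\bar x^{k+1})$, constant in $y$, is dropped in the third step. Its predictor is $\tilde u^k=(\tilde x^k,\tilde y^k)$ with $\tilde x^k=x^{k+1}$, $\tilde y^k=\bar y^{k+1}$; equivalently, $\tilde x^k=\arg\min\{\mathcal L(x,y^k)+\frac r2\|x-x^k\|^2:x\in\mathcal X\}$, $\tilde y^k=\arg\max\{\mathcal L(\tilde x^k+\alpha(\tilde x^k-x^k),y)-\frac s2\|y-y^k\|^2:y\in\mathcal Y\}$, and $u^{k+1}=u^k-M(u^k-\tilde u^k)$. *)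

(* Defs.v *)
From HB Require Import structures.
From mathcomp Require Import all_boot all_order all_algebra.
From mathcomp Require Import all_classical all_reals all_analysis.

Set Implicit Arguments.
Unset Strict Implicit.
Unset Printing Implicit Defensive.

Import Order.TTheory GRing.Theory Num.Theory.
Import numFieldNormedType.Exports.

Local Open Scope classical_set_scope.
Local Open Scope ring_scope.

Section Optimization.
Context {R : realType} {T : Type}.

Definition is_argmin (D : set T) (phi : T -> R) (x : T) : Prop :=
  D x /\ forall z, D z -> phi x <= phi z.

Definition is_argmax (D : set T) (phi : T -> R) (x : T) : Prop :=
  D x /\ forall z, D z -> phi z <= phi x.

End Optimization.

Section Euclidean.
Context {R : realType}.

(* Inner products are entries of 1 x 1 matrices. *)
Definition dotv p (v w : 'cV[R]_p) : R := (v^T *m w) 0 0.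

Definition sqnorm p (v : 'cV[R]_p) : R := dotv v v.

Definition sqnorm_mx p (S : 'M[R]_p) (v : 'cV[R]_p) : R := dotv v (S *m v).

(* The set of eigenvalues is finite, so [rho S] is its largest element as soon
   as it is nonempty (see [rho_max]); otherwise, as for p = 0, [rho S] is 0. *)
Definition rho p (S : 'M[R]_p) : R := sup [set a | eigenvalue S a].

Lemma finite_eigenvalues p (S : 'M[R]_p) : finite_set [set a | eigenvalue S a].
Proof.
apply: contrapT => /infinite_set_fset - /(_ (size (char_poly S))) [B subB leB].
suff : (size (finmap.enum_fset B) < size (char_poly S))%N by rewrite ltnNge leB.
apply: max_poly_roots; rewrite ?monic_neq0 ?char_poly_monic //.
- by apply/allP => a aB; rewrite -eigenvalue_root_char; apply: subB.
- exact: finmap.fset_uniq.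
Qed.

Lemma rho_max p (S : 'M[R]_p) (a : R) :
  eigenvalue S a -> eigenvalue S (rho S) /\ a <= rho S.
Proof.
have /finite_seqP[s sE] := finite_eigenvalues S.
have inE b : eigenvalue S b <-> b \in s.
  by have /(congr1 (fun A : set R => A b)) /= := sE; move=> ->.
have max_seq (t : seq R) b : b \in t ->
    exists2 c, c \in t & forall d, d \in t -> d <= c.
  elim: t b => [//|d [|e t] IH] b _.
    by exists d; rewrite ?mem_head // => c; rewrite mem_seq1 => /eqP ->.
  have [c ct cmax] := IH e (mem_head _ _).
  have [dc|cd] := leP d c.
    by exists c => [|x]; rewrite in_cons ?ct ?orbT // => /predU1P[->|/cmax].
  exists d; first exact: mem_head.
  by move=> x; rewrite in_cons => /predU1P[->//|/cmax /le_trans]; apply; apply: ltW.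
move=> Sa; have [c cs cmax] := max_seq s a (proj1 (inE a) Sa).
have ubc : ubound [set b | eigenvalue S b] c by move=> b /inE /cmax.
suff -> : rho S = c by split; [apply/inE | apply: ubc].
apply/le_anti/andP; split; first by apply: ge_sup => //; exists a.
by apply: ub_le_sup; [exists c | apply/inE].
Qed.

End Euclidean.

(* A function on X (or Y) is represented by a total function, of which only the
   values on X (or Y) are ever used. *)
Section SaddlePoint.
Context {R : realType} {n m : nat}.
Variables (X : set 'cV[R]_n) (Y : set 'cV[R]_m).
Variables (f : 'cV[R]_n -> R) (g : 'cV[R]_m -> R) (A : 'M[R]_(m, n)).

Definition lagrangian (x : 'cV[R]_n) (y : 'cV[R]_m) : R :=
  f x - dotv y (A *m x) - g y.

Definition Omega : set 'cV[R]_(n + m) :=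
  [set u | X (usubmx u) /\ Y (dsubmx u)].

Definition theta (u : 'cV[R]_(n + m)) : R := f (usubmx u) + g (dsubmx u).

Definition opF (u : 'cV[R]_(n + m)) : 'cV[R]_(n + m) :=
  col_mx (- (A^T *m dsubmx u)) (A *m usubmx u).

Definition Omega_star : set 'cV[R]_(n + m) :=
  [set us | Omega us /\
    forall u, Omega u -> 0 <= theta u - theta us + dotv (u - us) (opF us)].

Variables (alpha r s : R).

Definition matQ : 'M[R]_(n + m) :=
  block_mx r%:M A^T (alpha *: A) s%:M.

Definition matM : 'M[R]_(n + m) :=
  block_mx 1%:M 0 (- ((1 - alpha) * s^-1) *: A) 1%:M.

(* [matM] is lower unitriangular, so [invmx] is its genuine inverse. *)
Definition matH : 'M[R]_(n + m) := matQ *m invmx matM.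

(* The iterates are x k and y k; xbar k.+1 and ybar k.+1 are the intermediate
   points of step k, while xbar 0 and ybar 0 are irrelevant.  The objective of
   the third step is L(xbar k.+1, .) - s/2 |. - y k|^2 without the term
   f (xbar k.+1): it is constant in y, and xbar k.+1 may lie outside X. *)
Definition generalized_CP_PPA (x xbar : nat -> 'cV[R]_n)
    (y ybar : nat -> 'cV[R]_m) : Prop :=
  forall k : nat,
    [/\ is_argmin X (fun z => lagrangian z (y k) + r / 2 * sqnorm (z - x k))
          (x k.+1),
        xbar k.+1 = x k.+1 + alpha *: (x k.+1 - x k),
        is_argmax Y (fun z => - dotv z (A *m xbar k.+1) - g z
                              - s / 2 * sqnorm (z - y k)) (ybar k.+1) &
        y k.+1 = ybar k.+1 - ((1 - alpha) * s^-1) *: (A *m (x k.+1 - x k))].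

End SaddlePoint.

Section Iterates.
Context {R : realType} {n m : nat}.

Definition iterate (x : nat -> 'cV[R]_n) (y : nat -> 'cV[R]_m) (k : nat) :
  'cV[R]_(n + m) := col_mx (x k) (y k).

Definition predictor (x : nat -> 'cV[R]_n) (ybar : nat -> 'cV[R]_m) (k : nat) :
  'cV[R]_(n + m) := col_mx (x k.+1) (ybar k.+1).

End Iterates.

(* Main.v *)
(* Write d_k = u^k - ut^k.  The optimality conditions of the two proximal steps
   say that the predictor ut^k satisfies the variational inequality of Omega^*
   up to the term (u - ut^k)^T Q d_k.  Tested with u^* it gives the contraction
     |u^{k+1} - u^*|_H^2 <= |u^k - u^*|_H^2 - |d_k|_G^2,
   G = Q^T + Q - M^T H M; tested at ut^{k+1}, and that of step k+1 at ut^k, it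
   shows that |M d_k|_H is nonincreasing.  Under the condition on r s, G
   dominates a multiple c0 of M^T H M, and summing the contraction over
   k = 0, ..., N gives the rate. *)

Require Import Defs.
From HB Require Import structures.
From mathcomp Require Import all_boot all_order all_algebra.
From mathcomp Require Import all_classical all_reals all_analysis.
From mathcomp Require Import ring lra.

Set Implicit Arguments.
Unset Strict Implicit.
Unset Printing Implicit Defensive.

Import Order.TTheory GRing.Theory Num.Theory.
Import numFieldNormedType.Exports.

Local Open Scope classical_set_scope.
Local Open Scope ring_scope.

(** * Inner product and Cauchy-Schwarz for semidefinite forms *)

Section InnerProduct.
Context {R : realType} {p : nat}.
Implicit Types (u v w : 'cV[R]_p) (a : R).

Lemma dotvC v w : dotv v w = dotv w v.
Proof. by rewrite /dotv -[in RHS](trmxK v) -trmx_mul [RHS]mxE. Qed.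

Lemma dotvDl u v w : dotv (u + v) w = dotv u w + dotv v w.
Proof. by rewrite /dotv linearD mulmxDl mxE. Qed.

Lemma dotvDr u v w : dotv u (v + w) = dotv u v + dotv u w.
Proof. by rewrite /dotv mulmxDr mxE. Qed.

Lemma dotvNl v w : dotv (- v) w = - dotv v w.
Proof. by rewrite /dotv linearN mulNmx mxE. Qed.

Lemma dotvNr v w : dotv v (- w) = - dotv v w.
Proof. by rewrite /dotv mulmxN mxE. Qed.

Lemma dotvZl a v w : dotv (a *: v) w = a * dotv v w.
Proof. by rewrite /dotv linearZ -scalemxAl mxE. Qed.

Lemma dotvZr a v w : dotv v (a *: w) = a * dotv v w.
Proof. by rewrite /dotv -scalemxAr mxE. Qed.

Definition dotvE := (dotvDl, dotvDr, dotvNl, dotvNr, dotvZl, dotvZr).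

Lemma sqnorm_sum v : sqnorm v = \sum_i v i 0 ^+ 2.
Proof.
by rewrite /sqnorm /dotv mxE; apply: eq_bigr => i _; rewrite mxE expr2.
Qed.

Lemma sqnorm_ge0 v : 0 <= sqnorm v.
Proof. by rewrite sqnorm_sum sumr_ge0 // => i _; apply: sqr_ge0. Qed.

(** The form is nonnegative at [a *: v - b *: w]; suitable weights give the claim times [qw] or
    [qv]. If both vanish, the weights 1 and [q] give [- 2 * q ^+ 2 >= 0]. *)
Lemma cauchy_schwarz_mx (S : 'M[R]_p) v w : S^T = S ->
  (forall z, 0 <= sqnorm_mx S z) ->
  dotv v (S *m w) ^+ 2 <= sqnorm_mx S v * sqnorm_mx S w.
Proof.
move=> Ssym Spos.
have SC z1 z2 : dotv z1 (S *m z2) = dotv z2 (S *m z1).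
  by rewrite dotvC /dotv trmx_mul Ssym mulmxA.
have comb a b : 0 <= a ^+ 2 * sqnorm_mx S v
    - 2 * a * b * dotv v (S *m w) + b ^+ 2 * sqnorm_mx S w.
  have := Spos (a *: v - b *: w); rewrite /sqnorm_mx mulmxBr -!scalemxAr !dotvE.
  by rewrite (SC w v); lra.
have := Spos v; have := Spos w.
set q := dotv v _; set qv := sqnorm_mx S v; set qw := sqnorm_mx S w.
rewrite le0r => /predU1P[qw0|qw_gt0]; last first.
  move=> _; have := comb qw q; rewrite -/q -/qv -/qw.
  have -> : qw ^+ 2 * qv - 2 * qw * q * q + q ^+ 2 * qw = (qv * qw - q ^+ 2) * qw.
    by ring.
  by rewrite pmulr_lge0 // subr_ge0.
rewrite le0r => /predU1P[qv0|qv_gt0].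
  by have := comb 1 q; rewrite -/q -/qv -/qw qv0 qw0; lra.
have := comb q qv; rewrite -/q -/qv -/qw.
have -> : q ^+ 2 * qv - 2 * q * qv * q + qv ^+ 2 * qw = (qv * qw - q ^+ 2) * qv.
  by ring.
by rewrite pmulr_lge0 // subr_ge0.
Qed.

Lemma cauchy_schwarz v w : dotv v w ^+ 2 <= sqnorm v * sqnorm w.
Proof.
have E z : sqnorm_mx 1%:M z = sqnorm z by rewrite /sqnorm_mx mul1mx.
rewrite -{1}(mul1mx w) -!E; apply: cauchy_schwarz_mx; first exact: trmx1.
by move=> z; rewrite E sqnorm_ge0.
Qed.

End InnerProduct.

(** * Bounding |A x|^2 by the largest eigenvalue of A^T A *)

Section MatrixNorm.
Context {R : realType}.

Lemma dotv_mulmx p q (S : 'M[R]_(q, p)) (v : 'cV[R]_p) (w : 'cV[R]_q) :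
  dotv v (S^T *m w) = dotv w (S *m v).
Proof. by rewrite dotvC /dotv trmx_mul trmxK mulmxA. Qed.

Lemma dotv_col p q (v v' : 'cV[R]_p) (w w' : 'cV[R]_q) :
  dotv (col_mx v w) (col_mx v' w') = dotv v v' + dotv w w'.
Proof. by rewrite /dotv tr_col_mx mul_row_col mxE. Qed.

(** Cauchy-Schwarz on each row; the constant is the squared Frobenius norm. *)
Lemma sqnorm_mulmx_bounded p q (S : 'M[R]_(q, p)) :
  exists2 C : R, 0 <= C & forall v, sqnorm (S *m v) <= C * sqnorm v.
Proof.
exists (\sum_i sqnorm (row i S)^T); first by apply: sumr_ge0 => i _; exact: sqnorm_ge0.
move=> v; rewrite sqnorm_sum mulr_suml; apply: ler_sum => i _.
suff -> : (S *m v) i 0 = dotv (row i S)^T v by exact: cauchy_schwarz.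
by rewrite /dotv trmxK !mxE; apply: eq_bigr => j _; rewrite mxE.
Qed.

(* The least [l] with [|A x|^2 <= l |x|^2] makes [l - A^T A] positive
   semidefinite.  If this matrix were invertible, Cauchy-Schwarz for its
   quadratic form would bound the form below by a multiple of [|x|^2], and [l]
   could be decreased; so [l] is an eigenvalue. *)
Lemma sqnorm_mulmx_le_rho p q (A : 'M[R]_(q, p)) (v : 'cV[R]_p) :
  sqnorm (A *m v) <= rho (A^T *m A) * sqnorm v.
Proof.
have [C C_ge0 AC] := sqnorm_mulmx_bounded A.
have := sqnorm_ge0 v; rewrite le0r => /predU1P[v0|v_gt0].
  by have := AC v; rewrite v0 !mulr0.
pose U := [set l | forall z, sqnorm (A *m z) <= l * sqnorm z].
have UC : U C by [].
have lbU z : 0 < sqnorm z -> lbound U (sqnorm (A *m z) / sqnorm z).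
  by move=> z_gt0 l Ul; rewrite ler_pdivrMr.
have U0 : has_inf U by split; [exists C | exists (sqnorm (A *m v) / sqnorm v); apply: lbU].
pose l := inf U.
have Ul : U l.
  move=> z; have := sqnorm_ge0 z; rewrite le0r => /predU1P[z0|z_gt0].
    by have := AC z; rewrite z0 !mulr0.
  by rewrite -ler_pdivrMr //; apply: lb_le_inf; [case: U0 | exact: lbU].
have l_ge0 : 0 <= l.
  by have := le_trans (sqnorm_ge0 _) (Ul v); rewrite pmulr_lge0.
pose B := l%:M - A^T *m A.
have qB z : sqnorm_mx B z = l * sqnorm z - sqnorm (A *m z).
  by rewrite /sqnorm_mx mulmxBl mul_scalar_mx -mulmxA !dotvE dotv_mulmx.
have qB_ge0 z : 0 <= sqnorm_mx B z by rewrite qB subr_ge0.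
have Bsym : B^T = B by rewrite /B linearB /= tr_scalar_mx trmx_mul trmxK.
(* Cauchy-Schwarz for the form q of [B] at [B *m z] and [z]: |B z|^4 <= q(B z) q(z), where q(B z) <=
   l |B z|^2. *)
have Bl z : sqnorm (B *m z) <= l * sqnorm_mx B z.
  have := sqnorm_ge0 (B *m z); rewrite le0r => /predU1P[->|Bz_gt0].
    by rewrite mulr_ge0.
  rewrite -(ler_pM2l Bz_gt0) -expr2.
  apply: le_trans (cauchy_schwarz_mx _ _ Bsym qB_ge0) _.
  rewrite mulrA; apply: ler_wpM2r => //.
  by rewrite qB mulrC gerBl sqnorm_ge0.
suff /rho_max[_ lrho] : eigenvalue (A^T *m A) l.
  by apply: le_trans (Ul v) _; rewrite ler_wpM2r // sqnorm_ge0.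
rewrite /eigenvalue /eigenspace kermx_eq0 row_free_unit.
apply/negP; set E := A^T *m A - l%:M => Eunit.
have [C' C'_ge0 EC'] := sqnorm_mulmx_bounded (invmx E).
(* |z|^2 <= C' |B z|^2 <= C' l q(z) <= K q(z), so [l - K^-1] still belongs to [U]; the 1 keeps [K]
   positive. *)
pose K := C' * l + 1.
have K_gt0 : 0 < K by rewrite ltr_wpDl // mulr_ge0.
have UK : U (l - K^-1).
  move=> z; rewrite mulrBl lerBrDr -lerBrDl -qB mulrC ler_pdivrMr //.
  have := EC' (E *m z); rewrite mulKmx //.
  have -> : sqnorm (E *m z) = sqnorm (B *m z).
    have -> : B = - E by rewrite opprB.
    by rewrite mulNmx /sqnorm dotvNl dotvNr opprK.
  move=> /le_trans; apply; apply: le_trans (ler_wpM2l C'_ge0 (Bl z)) _.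
  by rewrite mulrA mulrC; apply: ler_wpM2l => //; rewrite /K lerDl.
have := ge_inf (proj2 U0) UK; rewrite -/l.
by rewrite lerBrDr gerDl leNgt invr_gt0 K_gt0.
Qed.

End MatrixNorm.

(** * Optimality condition of a proximal step *)

Section ProximalStep.
Context {R : realType} {p : nat}.

(* Compare the minimizer [z0] with [z0 + t (z - z0)], divide by [t], and let
   [t] tend to 0. *)
Lemma argmin_prox_vi (D : set 'cV[R]_p) (phi : 'cV[R]_p -> R) (b c : 'cV[R]_p)
    (a : R) (z0 z : 'cV[R]_p) :
  convex_set D -> convex_function D phi ->
  is_argmin D (fun z => phi z + dotv z b + a / 2 * sqnorm (z - c)) z0 ->
  D z -> 0 <= phi z - phi z0 + dotv (z - z0) (b + a *: (z0 - c)).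
Proof.
move=> cD cphi [Dz0 min0] Dz.
set P := leRHS.
suff Pt t : 0 < t -> t <= 1 -> 0 <= P + t * (a / 2 * sqnorm (z - z0)).
  rewrite leNgt; apply/negP => P_lt0.
  set q := a / 2 * sqnorm (z - z0) in Pt.
  have q_gt0 : 0 < q by have := Pt 1 ltr01 (lexx _); lra.
  have Pq : - P <= q by have := Pt 1 ltr01 (lexx _); lra.
  (* Instead of a limit, a single [t]: it turns the bound into [P / 2 >= 0], and [Pq] gives
     [t <= 1]. *)
  have := Pt (- P / (2 * q)).
  rewrite divr_gt0 ?ler_pdivrMr; try lra.
  have -> : - P / (2 * q) * q = - P / 2 by field; lra.
  by move=> /(_ isT); lra.
move=> t_gt0 t_le1.
pose i := Itv01 (ltW t_gt0) t_le1.
have zt : conv i (z : convex_lmodType _) (z0 : convex_lmodType _) =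
    z0 + t *: (z - z0).
  rewrite /conv /= /unstable.onem /= scalerBl scale1r scalerBr.
  by rewrite addrCA addrA.
have Dzt : D (z0 + t *: (z - z0)).
  by rewrite -zt; apply/set_mem/cD; apply/mem_set.
have := cphi i z z0 (mem_set Dz) (mem_set Dz0); rewrite zt convRE /=.
have := min0 _ Dzt.
have -> : z0 + t *: (z - z0) - c = (z0 - c) + t *: (z - z0).
  by rewrite addrAC.
rewrite /P /sqnorm /unstable.onem.
move: (z - z0) (z0 - c) => h e.
move: (phi (z0 + _)) => phit.
rewrite !dotvE [dotv e h]dotvC => H1 H2.
rewrite -(pmulr_rge0 _ t_gt0); lra.
Qed.

End ProximalStep.

(** * Contraction, monotonicity and rate for abstract [Q], [M], [H] *)

Section Rate.
Context {R : realType} {p : nat}.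
Variables (Q M H : 'M[R]_p) (c0 : R) (u ut : nat -> 'cV[R]_p) (us : 'cV[R]_p).
Hypotheses (Hsym : H^T = H) (HM : H *m M = Q).
Hypothesis Hpos : forall v, 0 <= sqnorm_mx H v.
Hypothesis c0_gt0 : 0 < c0.
(* The form on the right is that of [Q^T + Q - M^T H M]. *)
Hypothesis Gpos : forall v,
  c0 * sqnorm_mx H (M *m v) <= 2 * dotv v (Q *m v) - sqnorm_mx H (M *m v).
Hypothesis step : forall k, u k.+1 = u k - M *m (u k - ut k).
Hypothesis vi_star : forall k, 0 <= dotv (ut k - us) (Q *m (u k - ut k)).
Hypothesis vi_step : forall k,
  0 <= dotv (ut k - ut k.+1) (Q *m ((u k - ut k) - (u k.+1 - ut k.+1))).

Let dotHC v w : dotv v (H *m w) = dotv w (H *m v).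
Proof. by rewrite -{1}Hsym dotv_mulmx. Qed.

Let sqnormHB v w :
  sqnorm_mx H (v - w) = sqnorm_mx H v - 2 * dotv v (H *m w) + sqnorm_mx H w.
Proof. by rewrite /sqnorm_mx mulmxBr !dotvE (dotHC w v); ring. Qed.

Lemma correction_contraction k :
  c0 * sqnorm_mx H (M *m (u k - ut k)) <=
    sqnorm_mx H (u k - us) - sqnorm_mx H (u k.+1 - us).
Proof.
rewrite step addrAC [sqnorm_mx H (_ - M *m _)]sqnormHB (mulmxA H M) HM.
apply: le_trans (Gpos _) _.
have := vi_star k; set d := u k - ut k.
have -> : ut k - us = (u k - us) - d by rewrite /d opprB [RHS]addrC addrA subrK.
rewrite !dotvE; lra.
Qed.

(** Since ut^k - ut^{k+1} = M d - (d - d'), [vi_step] bounds (M d)^T Q (d - d') below by the form of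
    Q at d - d'; the decrease is then at least the G-form there. *)
Lemma correction_decreasing k :
  sqnorm_mx H (M *m (u k.+1 - ut k.+1)) <= sqnorm_mx H (M *m (u k - ut k)).
Proof.
have := vi_step k; set d := u k - ut k; set d' := u k.+1 - ut k.+1.
have -> : ut k - ut k.+1 = M *m d - (d - d').
  have -> : M *m d = u k - u k.+1 by rewrite step opprB addrC subrK.
  rewrite /d /d'; apply/matrixP => i j; rewrite !mxE; ring.
rewrite dotvDl dotvNl => vi.
have := Gpos (d - d').
have := mulr_ge0 (ltW c0_gt0) (Hpos (M *m (d - d'))).
have : sqnorm_mx H (M *m d') = sqnorm_mx H (M *m d - M *m (d - d')).
  by rewrite -mulmxBr subKr.
rewrite sqnormHB (mulmxA H M) HM; lra.
Qed.

Lemma correction_rate N :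
  sqnorm_mx H (M *m (u N - ut N)) <=
    1 / ((N%:R + 1) * c0) * sqnorm_mx H (u 0%N - us).
Proof.
have N1_gt0 : 0 < N%:R + 1 :> R by rewrite ltr_wpDl.
rewrite mul1r mulrC ler_pdivlMr ?mulr_gt0 //.
(* The contraction telescopes, each summand being replaced by the last and smallest one; the N + 1
   indices 0, ..., N give the factor. *)
suff sumE k : (k <= N.+1)%N -> k%:R * (c0 * sqnorm_mx H (M *m (u N - ut N))) <=
    sqnorm_mx H (u 0%N - us) - sqnorm_mx H (u k - us).
  by have := sumE N.+1 (leqnn _); have := Hpos (u N.+1 - us); lra.
elim: k => [|k IH kN]; first by rewrite mul0r subrr.
have mono : sqnorm_mx H (M *m (u N - ut N)) <= sqnorm_mx H (M *m (u k - ut k)).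
  rewrite -(subnK (kN : (k <= N)%N)); elim: (N - k)%N => [|j] //.
  by apply: le_trans; rewrite addSn; exact: correction_decreasing.
have := IH (ltnW kN); have := correction_contraction k.
have := ler_wpM2l (ltW c0_gt0) mono; rewrite -natr1; lra.
Qed.

End Rate.

(** * Block forms of [Q], [M], [H] and skewness of [opF] *)

Section Scheme.
Context {R : realType} {n m : nat}.
Variables (A : 'M[R]_(m, n)) (alpha r s : R).

Local Notation Q := (matQ A alpha r s).
Local Notation M := (matM A alpha s).
Local Notation H := (matH A alpha r s).

Lemma matM_unit : M \in unitmx.
Proof.
pose M' : 'M[R]_(n + m) := block_mx 1%:M 0 (((1 - alpha) * s^-1) *: A) 1%:M.
suff MM' : M *m M' = 1%:M by have [] := mulmx1_unit MM'.
rewrite mulmx_block !mul1mx !mulmx1 !mul0mx mulmx0 !addr0 add0r.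
by rewrite scaleNr addNr -scalar_mx_block.
Qed.

Lemma matHM : H *m M = Q.
Proof. by rewrite /matH mulmxKV // matM_unit. Qed.

Lemma matH_block : s != 0 ->
  H = block_mx (r%:M + ((1 - alpha) * s^-1) *: (A^T *m A)) A^T A s%:M.
Proof.
move=> s0; apply: (can_inj (mulmxK matM_unit)).
rewrite matHM mulmx_block !mulmx1 !mulmx0 !add0r; congr block_mx.
  by rewrite scaleNr mulmxN -scalemxAr addrK.
rewrite scaleNr mulmxN mul_scalar_mx scalerA mulrCA divff // mulr1.
by rewrite scalerBl scale1r subKr.
Qed.

Lemma matH_sym : s != 0 -> H^T = H.
Proof.
move=> s0; rewrite matH_block // tr_block_mx !tr_scalar_mx trmxK.
by rewrite linearD linearZ /= tr_scalar_mx trmx_mul trmxK.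
Qed.

Lemma matM_col (x : 'cV[R]_n) (y : 'cV[R]_m) :
  M *m col_mx x y = col_mx x (y - ((1 - alpha) * s^-1) *: (A *m x)).
Proof.
by rewrite mul_block_col !mul1mx mul0mx addr0 scaleNr mulNmx -scalemxAl addrC.
Qed.

Lemma matQ_col (x : 'cV[R]_n) (y : 'cV[R]_m) :
  Q *m col_mx x y = col_mx (r *: x + A^T *m y) (alpha *: (A *m x) + s *: y).
Proof. by rewrite mul_block_col !mul_scalar_mx -scalemxAl. Qed.

Lemma sqnorm_matH_col (x : 'cV[R]_n) (y : 'cV[R]_m) : s != 0 ->
  sqnorm_mx H (col_mx x y) =
  r * sqnorm x + (1 - alpha) / s * sqnorm (A *m x) + 2 * dotv y (A *m x)
    + s * sqnorm y.
Proof.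
move=> s0; rewrite /sqnorm_mx matH_block // mul_block_col mulmxDl !mul_scalar_mx.
rewrite -scalemxAl -mulmxA dotv_col !dotvE !dotv_mulmx /sqnorm; ring.
Qed.

(** [opF] is linear with a skew-symmetric matrix, so (v - w)^T F(v - w) = 0. *)
Lemma opF_skew (v w : 'cV[R]_(n + m)) :
  dotv (v - w) (opF A v) = dotv (v - w) (opF A w).
Proof.
rewrite -(vsubmxK v) -(vsubmxK w) /opF !col_mxKu !col_mxKd opp_col_mx add_col_mx.
rewrite !dotv_col !dotvE !dotv_mulmx; ring.
Qed.

(** * Positivity of H and of G *)

Section Positivity.
Hypotheses (alpha_ge0 : 0 <= alpha) (alpha_le1 : alpha <= 1).
Hypotheses (s_gt0 : 0 < s).
Hypothesis rs_gt : (1 - alpha + alpha ^+ 2) * rho (A^T *m A) < r * s.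

Let s_neq0 : s != 0. Proof. exact: lt0r_neq0. Qed.

Let K := 1 - alpha + alpha ^+ 2.

Let K_ge0 : 0 <= K.
Proof. by rewrite /K; nra. Qed.

Let K_mul x : K * sqnorm (A *m x) <= K * rho (A^T *m A) * sqnorm x.
Proof. by rewrite -mulrA ler_wpM2l // sqnorm_mulmx_le_rho. Qed.

Let sqnorm_comb a x y : sqnorm (s *: y + a *: (A *m x)) =
  s ^+ 2 * sqnorm y + 2 * a * s * dotv y (A *m x) + a ^+ 2 * sqnorm (A *m x).
Proof. by rewrite /sqnorm !dotvE [dotv (A *m x) y]dotvC; ring. Qed.

(** As K - alpha = (1 - alpha)^2, [s] times the form is (r s |x|^2 - K |A x|^2) + (1 - alpha)^2 |A
    x|^2 + |s y + A x|^2. *)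
Lemma matH_psd v : 0 <= sqnorm_mx H v.
Proof.
rewrite -(vsubmxK v) sqnorm_matH_col //.
move: (usubmx v) (dsubmx v) => x y.
rewrite -(pmulr_rge0 _ s_gt0).
set q := leRHS.
have -> : q = r * s * sqnorm x + (1 - alpha) * sqnorm (A *m x)
    + 2 * s * dotv y (A *m x) + s ^+ 2 * sqnorm y by rewrite /q; field.
have := sqnorm_ge0 (s *: y + 1 *: (A *m x)); rewrite sqnorm_comb.
have := ler_wpM2r (sqnorm_ge0 x) (ltW rs_gt); have := K_mul x.
have := mulr_ge0 (sqr_ge0 (1 - alpha)) (sqnorm_ge0 (A *m x)).
by rewrite /K; lra.
Qed.

(* With [W := |s y + A x|^2], [s] times the right-hand side is
   [r s |x|^2 - K |A x|^2 + W >= (r s - K rho) |x|^2 + W], while [s] times the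
   norm on the left is at most [(r s + 2 |rho|) |x|^2 + 2 W]. *)
Lemma matG_ge : exists2 c0 : R, 0 < c0 & forall v,
  c0 * sqnorm_mx H (M *m v) <= 2 * dotv v (Q *m v) - sqnorm_mx H (M *m v).
Proof.
pose d := r * s - K * rho (A^T *m A).
pose e := r * s + 2 * `|rho (A^T *m A)|.
have d_gt0 : 0 < d by rewrite subr_gt0.
have e_gt0 : 0 < e.
  have K1 : K <= 1.
    by have := ler_wpM2l alpha_ge0 alpha_le1; rewrite /K; lra.
  have N_ge0 := normr_ge0 (rho (A^T *m A)).
  have rhoN : - rho (A^T *m A) <= `|rho (A^T *m A)| by rewrite -normrN ler_norm.
  have := ler_wpM2l K_ge0 rhoN; have := ler_wpM2r N_ge0 K1.
  by move: rs_gt; rewrite -/K /e; lra.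
(* [d / e] compares the coefficients of |x|^2, and 1/2 those of W. *)
exists (Num.min (1 / 2) (d / e)).
  by rewrite lt_min !divr_gt0.
set c0 := Num.min _ _ => v.
have c0_gt0 : 0 < c0 by rewrite /c0 lt_min !divr_gt0.
have c0e : c0 * e <= d by rewrite -ler_pdivlMr // /c0 ge_min lexx orbT.
have c0h : c0 * 2 <= 1 by rewrite -ler_pdivlMr // /c0 ge_min lexx.
rewrite -(vsubmxK v); move: (usubmx v) (dsubmx v) => x y.
have MHM : s * sqnorm_mx H (M *m col_mx x y) =
    r * s * sqnorm x - alpha * sqnorm (A *m x) + sqnorm (s *: y + alpha *: (A *m x)).
  rewrite matM_col sqnorm_matH_col // sqnorm_comb /sqnorm !dotvE.
  by rewrite [dotv (A *m x) y]dotvC; field.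
have MQ : s * dotv (col_mx x y) (Q *m col_mx x y) =
    r * s * sqnorm x + (1 + alpha) * s * dotv y (A *m x) + s ^+ 2 * sqnorm y.
  by rewrite matQ_col dotv_col !dotvE dotv_mulmx /sqnorm; ring.
(* Parallelogram law for s y + A x and (1 - alpha) A x. *)
have le2 : sqnorm (s *: y + alpha *: (A *m x)) <=
    2 * sqnorm (s *: y + 1 *: (A *m x)) + 2 * (1 - alpha) ^+ 2 * sqnorm (A *m x).
  have := sqnorm_ge0 (s *: y + (2 - alpha) *: (A *m x)).
  by rewrite !sqnorm_comb; lra.
have GE : s * (2 * dotv (col_mx x y) (Q *m col_mx x y)
               - sqnorm_mx H (M *m col_mx x y)) =
    r * s * sqnorm x - K * sqnorm (A *m x) + sqnorm (s *: y + 1 *: (A *m x)).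
  by rewrite mulrBr mulrCA MQ MHM !sqnorm_comb /K; ring.
rewrite -(ler_pM2l s_gt0) mulrCA GE.
set a := sqnorm (A *m x) in MHM le2 *; set b := sqnorm x in MHM *.
set W := sqnorm (s *: y + 1 *: _) in le2 *.
have a_ge0 : 0 <= a := sqnorm_ge0 _.
have b_ge0 : 0 <= b := sqnorm_ge0 _.
have W_ge0 : 0 <= W := sqnorm_ge0 _.
have a_le : a <= `|rho (A^T *m A)| * b.
  apply: le_trans (sqnorm_mulmx_le_rho _ _) _.
  by rewrite ler_wpM2r // ler_norm.
have top : s * sqnorm_mx H (M *m col_mx x y) <= e * b + 2 * W.
  have : (2 * (1 - alpha) ^+ 2 - alpha) * a <= 2 * a.
    apply: ler_wpM2r => //.
    by have := ler_wpM2l alpha_ge0 alpha_le1; move: alpha_ge0; lra.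
  rewrite MHM /e; lra.
apply: le_trans (ler_wpM2l (ltW c0_gt0) top) _.
have := ler_wpM2r b_ge0 c0e; have := ler_wpM2r W_ge0 c0h; have := K_mul x.
rewrite -/a -/b /d; lra.
Qed.

End Positivity.
End Scheme.

(** * Variational inequality of the predictor *)

Section PredictorVI.
Context {R : realType} {n m : nat}.
Variables (X : set 'cV[R]_n) (Y : set 'cV[R]_m).
Variables (f : 'cV[R]_n -> R) (g : 'cV[R]_m -> R) (A : 'M[R]_(m, n)).
Variables (alpha r s : R).
Variables (x xbar : nat -> 'cV[R]_n) (y ybar : nat -> 'cV[R]_m).
Hypotheses (convexX : convex_set X) (convexY : convex_set Y).
Hypotheses (convexf : convex_function X f) (convexg : convex_function Y g).
Hypothesis algo : generalized_CP_PPA X Y f g A alpha r s x xbar y ybar.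

Local Notation Q := (matQ A alpha r s).
Local Notation u := (iterate x y).
Local Notation ut := (predictor x ybar).

Lemma predictor_Omega k : Omega X Y (ut k).
Proof.
by have [[Xx _] _ [Yy _] _] := algo k; split; rewrite ?col_mxKu ?col_mxKd.
Qed.

(** Sum of the two proximal conditions. Replacing [y k] by [ybar k.+1] and [xbar k.+1] by [x k.+1]
    in their linear terms produces the blocks A^T and alpha A of Q. *)
Lemma predictor_vi k v : Omega X Y v ->
  dotv (v - ut k) (Q *m (u k - ut k)) <=
    theta f g v - theta f g (ut k) + dotv (v - ut k) (opF A (ut k)).
Proof.
have [[Xx minx] xbE [Yy maxy] _] := algo k.
rewrite -(vsubmxK v); move: (usubmx v) (dsubmx v) => z w [].
rewrite col_mxKu col_mxKd => Xz Yw.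
have vix : 0 <= f z - f (x k.+1)
    + dotv (z - x k.+1) (- (A^T *m y k) + r *: (x k.+1 - x k)).
  apply: argmin_prox_vi Xz => //; split=> // z' /minx.
  rewrite /lagrangian !dotvNr !dotv_mulmx; lra.
have viy : 0 <= g w - g (ybar k.+1)
    + dotv (w - ybar k.+1) (A *m xbar k.+1 + s *: (ybar k.+1 - y k)).
  by apply: argmin_prox_vi Yw => //; split=> // w' /maxy; lra.
rewrite /theta /opF !col_mxKu !col_mxKd !opp_col_mx !add_col_mx matQ_col !dotv_col.
move: vix viy; rewrite xbE !mulmxDr -!scalemxAr !mulmxDr !mulmxN !dotvE; lra.
Qed.

End PredictorVI.

Theorem theorem5p3 (R : realType) (n m : nat)
  (X : set 'cV[R]_n) (Y : set 'cV[R]_m)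
  (f : 'cV[R]_n -> R) (g : 'cV[R]_m -> R)
  (A : 'M[R]_(m, n)) (alpha r s : R)
  (x xbar : nat -> 'cV[R]_n) (y ybar : nat -> 'cV[R]_m)
  (closedX : closed X) (convexX : convex_set X)
  (closedY : closed Y) (convexY : convex_set Y)
  (convexf : convex_function X f) (convexg : convex_function Y g)
  (alpha_ge0 : 0 <= alpha) (alpha_le1 : alpha <= 1)
  (r_gt0 : 0 < r) (s_gt0 : 0 < s)
  (rs_gt : (1 - alpha + alpha ^+ 2) * rho (A^T *m A) < r * s)
  (algo : generalized_CP_PPA X Y f g A alpha r s x xbar y ybar) :
  let u := iterate x y in
  let ut := predictor x ybar in
  let M := matM A alpha s in
  let H := matH A alpha r s in
  exists2 c0 : R, 0 < c0 &
    forall N : nat, (0 < N)%N ->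
    forall us : 'cV[R]_(n + m), Omega_star X Y f g A us ->
      sqnorm_mx H (M *m (u N - ut N))
        <= 1 / ((N%:R + 1) * c0) * sqnorm_mx H (u 0%N - us).
Proof.
move=> /=.
have [c0 c0_gt0 G_ge] := matG_ge alpha_ge0 alpha_le1 s_gt0 rs_gt.
exists c0 => // N _ us [Ous star].
have Out := predictor_Omega algo.
have vi := predictor_vi convexX convexY convexf convexg algo.
apply: (correction_rate (matH_sym _ _ _ (lt0r_neq0 s_gt0)) (matHM _ _ _ _)) => //.
- exact: matH_psd.
- move=> k; have [_ _ _ yE] := algo k.
  rewrite /iterate /predictor opp_col_mx add_col_mx matM_col.
  rewrite opp_col_mx add_col_mx subKr yE; congr col_mx.
  by rewrite -[x k - x k.+1]opprB mulmxN scalerN opprK opprD addrA subKr.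
(* The theta terms cancel in the sum, and the F terms by skewness; likewise for two consecutive
   predictors below. *)
- move=> k; have := vi k us Ous; have := star _ (Out k).
  rewrite -opF_skew -[us - predictor _ _ k]opprB !dotvNl; lra.
- move=> k; rewrite mulmxBr dotvDr dotvNr.
  have := vi k _ (Out k.+1); have := vi k.+1 _ (Out k).
  have := opF_skew A (predictor x ybar k) (predictor x ybar k.+1).
  rewrite -[predictor _ _ k.+1 - _]opprB !dotvNl; lra.
Qed.
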